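(* Let $\mathcal M$ be a $\mathrm{B}^{\mathrm{PN}}$-matrix over a signature $\Sigma$ and let $\Theta$ be a discriminator for $\mathcal M$. Then the calculus $\mathcal R_{\mathcal M,\Theta}$ is sound with respect to $\mathcal M$: every B-statement provable in $\mathcal R_{\mathcal M,\Theta}$ holds in $\mathcal M$.
   Context: Signatures and formulas: $\Sigma=(\Sigma_k)_{k\in\mathbb N}$ is a family of sets of $k$-ary connectives; $L_\Sigma$ is the set of formulas over a denumerable set $P$ of variables; substitutions are endomorphisms of the formula algebra. For a set $\Theta$ of formulas in a single variable $p$, $\Theta(\varphi)=\{\psi(\varphi):\psi\in\Theta\}$, where $\psi(\varphi)$ substitutes $\varphi$ for $p$. A B-statement is a quadruple $\Phi=(\Phi_{\mathsf A},\Phi_{\overline{\mathsf A}},\Phi_{\mathsf R},\Phi_{\overline{\mathsf R}})$ of sets of formulas. A $\mathrm{B}^{\mathrm{PN}}$-matrix is $\mathcal M=(V,D,D',\cdot^{\mathcal M})$ with $D,D'\subseteq V$ and, for each $\copyright\in\Sigma_k$, $\copyright^{\mathcal M}:V^k\to\mathcal P(V)$ (possibly empty outputs). Put $\mathcal D_{\mathsf A}=D$, $\mathcal D_{\overline{\mathsf A}}=V\setminus D$, $\mathcal D_{\mathsf R}=D'$, $\mathcal D_{\overline{\mathsf R}}=V\setminus D'$. An $\mathcal M$-valuation is $v:L_\Sigma\to V$ with $v(\copyright(\varphi_1,\dots,\varphi_k))\in\copyright^{\mathcal M}(v(\varphi_1),\dots,v(\varphi_k))$. $\Phi$ holds in $\mathcal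 M$ iff there is no $\mathcal M$-valuation $v$ with $v(\Phi_\alpha)\subseteq\mathcal D_\alpha$ for all $\alpha\in\{\mathsf A,\overline{\mathsf A},\mathsf R,\overline{\mathsf R}\}$. For single-variable $\psi$, $\psi^{\mathcal M}(x)=\{v(\psi): v(p)=x\}$. For nonempty $X\subseteq V$, the sub-matrix induced by $X$ has values $X$ and interpretations $\copyright^{\mathcal M}(\vec x)\cap X$ for $\vec x\in X^k$; it is total if no such interpretation is empty. $\mathsf T(\mathcal M)=\bigcup\{\mathcal P(X):\emptyset\ne X\subseteq V,\ \text{the sub-matrix induced by }X\text{ is total}\}$. Discriminators: $X,Y\subseteq V$ are $\alpha$-separated ($\alpha\in\{\mathsf A,\mathsf R\}$) if $X\subseteq\mathcal D_\alpha$ and $Y\subseteq V\setminus\mathcal D_\alpha$ or vice versa; a single-variable $\psi$ is a monadic separator for $x,y$ if $\psi^{\mathcal M}(x),\psi^{\mathcal M}(y)$ are $\alpha$-separated for some such $\alpha$; a set isolates $x$ if it contains a monadic separator for $x,y$ for every $y\ne x$. A discriminator for $\mathcal M$ is a family $\big((\Theta^x_{\mathsf A},\Theta^x_{\overline{\mathsf A}},\Theta^x_{\mathsf R},\Theta^x_{\overline{\mathsf R}})\big)_{x\in V}$ of sets of formulas in the single variable $p$ such that $\bigcup_\alpha\Theta^x_\alpha$ isolates $x$ and $\psi^{\mathcal M}(x)\subseteq\mathcal D_\alpha$ whenever $\psi\in\Theta^x_\alpha$. Calculi: a rule schema has an antecedent $(\Delta_{\mathsf A},\Delta_{\mathsf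 R})$ and a succedent $(\Delta_{\overline{\mathsf A}},\Delta_{\overline{\mathsf R}})$ (pairs of sets of formulas); instances arise by applying a substitution to all four sets; a calculus is a set of rule schemas. Derivations are rooted trees in which every branch ends in a leaf, whose nodes are labelled either by a pair $(\Gamma_{\mathsf A},\Gamma_{\mathsf R})$ of sets of formulas or by $\star$. An instance is applicable to $(\Gamma_{\mathsf A},\Gamma_{\mathsf R})$ if $\Delta_{\mathsf A}\subseteq\Gamma_{\mathsf A}$ and $\Delta_{\mathsf R}\subseteq\Gamma_{\mathsf R}$. In a derivation each non-leaf node is expanded by an applicable instance: if $\Delta_{\overline{\mathsf A}}\cup\Delta_{\overline{\mathsf R}}=\emptyset$ the node has a single child labelled $\star$; otherwise its children are exactly nodes labelled $(\Gamma_{\mathsf A}\cup\{\psi\},\Gamma_{\mathsf R})$ for $\psi\in\Delta_{\overline{\mathsf A}}$ and $(\Gamma_{\mathsf A},\Gamma_{\mathsf R}\cup\{\psi\})$ for $\psi\in\Delta_{\overline{\mathsf R}}$. A proof of $\Phi$ is a derivation whose root label $(\Gamma_{\mathsf A},\Gamma_{\mathsf R})$ satisfies $\Gamma_{\mathsf A}\subseteq\Phi_{\mathsf A}$, $\Gamma_{\mathsf R}\subseteq\Phi_{\mathsf R}$, and each leaf is labelled $\star$ or by some $(\Gamma'_{\mathsf A},\Gamma'_{\mathsf R})$ with $\Gamma'_{\mathsf A}\cap\Phi_{\overline{\mathsf A}}\ne\emptyset$ or $\Gamma'_{\mathsf R}\cap\Phi_{\overline{\mathsf R}}\ne\emptyset$.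 The calculus $\mathcal R_{\mathcal M,\Theta}$. For $X\subseteq V$, a choice for $X$ w.r.t. $(\mathsf A,\mathsf R)$ is a pair $(\hat\Theta^X_{\mathsf A},\hat\Theta^X_{\mathsf R})$ obtained by choosing, for each $x\in X$, one formula from $\Theta^x_{\mathsf A}\cup\Theta^x_{\mathsf R}$, and putting it into $\hat\Theta^X_{\mathsf A}$ if chosen from $\Theta^x_{\mathsf A}$ and into $\hat\Theta^X_{\mathsf R}$ if chosen from $\Theta^x_{\mathsf R}$; a choice $(\hat\Theta^X_{\overline{\mathsf A}},\hat\Theta^X_{\overline{\mathsf R}})$ w.r.t. $(\overline{\mathsf A},\overline{\mathsf R})$ is defined analogously. For $x\in V$ and $\beta\in\{\mathsf A,\overline{\mathsf A},\mathsf R,\overline{\mathsf R}\}$, let $P_\beta(x)=\{p\}$ if $x\in\mathcal D_\beta$ and $\emptyset$ otherwise. Rules (antecedent ; succedent): (∃) for each $X\subseteq V$, $\bar X=V\setminus X$, each choice for $\bar X$ w.r.t. $(\mathsf A,\mathsf R)$ and each choice for $X$ w.r.t. $(\overline{\mathsf A},\overline{\mathsf R})$: antecedent $(\hat\Theta^X_{\overline{\mathsf A}},\hat\Theta^X_{\overline{\mathsf R}})$, succedent $(\hat\Theta^{\bar X}_{\mathsf A},\hat\Theta^{\bar X}_{\mathsf R})$ (formulas in the variable $p$). (D) for each $x\in V$, two rules: antecedent $(\Theta^x_{\mathsf A}(p)\cup P_{\overline{\mathsf A}}(x),\ \Theta^x_{\mathsf R}(p))$, succedent $(\Theta^x_{\overline{\mathsf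 A}}(p)\cup P_{\mathsf A}(x),\ \Theta^x_{\overline{\mathsf R}}(p))$; and antecedent $(\Theta^x_{\mathsf A}(p),\ \Theta^x_{\mathsf R}(p)\cup P_{\overline{\mathsf R}}(x))$, succedent $(\Theta^x_{\overline{\mathsf A}}(p),\ \Theta^x_{\overline{\mathsf R}}(p)\cup P_{\mathsf R}(x))$. (Σ) for each $\copyright\in\Sigma_k$, each $(x_1,\dots,x_k)\in V^k$, each $y\notin\copyright^{\mathcal M}(x_1,\dots,x_k)$ and distinct variables $p_1,\dots,p_k$, letting $S_\beta=\bigcup_{i}\Theta^{x_i}_\beta(p_i)\cup\Theta^y_\beta(\copyright(p_1,\dots,p_k))$: antecedent $(S_{\mathsf A},S_{\mathsf R})$, succedent $(S_{\overline{\mathsf A}},S_{\overline{\mathsf R}})$. (T) for each $X\subseteq V$ with $X\notin\mathsf T(\mathcal M)$ and distinct variables $(p_x)_{x\in X}$: antecedent $(\bigcup_{x\in X}\Theta^x_{\mathsf A}(p_x),\bigcup_{x\in X}\Theta^x_{\mathsf R}(p_x))$, succedent $(\bigcup_{x\in X}\Theta^x_{\overline{\mathsf A}}(p_x),\bigcup_{x\in X}\Theta^x_{\overline{\mathsf R}}(p_x))$.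
   Formalization: The definition of discriminator gets one added clause, without which the claim is false: for all x and y≠x there are an index α and ψ in Θ^x_α such that ψ^M(y) lies in the complement of D_α, i.e. separators are filed under an index for which they separate. *)

(* Defs.v *)
From mathcomp Require Import all_boot.
From mathcomp Require Import boolp classical_sets.

Set Implicit Arguments.
Unset Strict Implicit.
Unset Printing Implicit Defensive.

Local Open Scope classical_set_scope.

(** * Formulas *)

(** A signature is a family [Sg : nat -> Type], [Sg k] being the set of [k]-ary
    connectives.  The denumerable set of variables is [nat]. *)
Inductive formula (Sg : nat -> Type) : Type :=
| Var of nat
| App k of Sg k & ('I_k -> formula Sg).
Arguments Var {Sg} _.
Arguments App {Sg k} _ _.

(** An endomorphism of the formula algebra is given by its values on variables. *)
Fixpoint subst (Sg : nat -> Type) (s : nat -> formula Sg) (phi : formula Sg)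
    : formula Sg :=
  match phi with
  | Var n => s n
  | App _ c args => App c (fun i => subst s (args i))
  end.

Fixpoint single_var (Sg : nat -> Type) (p : nat) (phi : formula Sg) : Prop :=
  match phi with
  | Var n => n = p
  | App _ _ args => forall i, single_var p (args i)
  end.

(** [Theta(phi)], for a set [Theta] of formulas in the single variable [p]. *)
Definition set_at (Sg : nat -> Type) (p : nat) (Theta : set (formula Sg))
    (phi : formula Sg) : set (formula Sg) :=
  subst (fun n => if n == p then phi else Var n) @` Theta.

(** * B-statements *)

(** The four indices: accepted, non-accepted, rejected, non-rejected. *)
Inductive corner : Set := Acc | NAcc | Rej | NRej.

Definition opp (a : corner) : corner :=
  match a with Acc => NAcc | NAcc => Acc | Rej => NRej | NRej => Rej end.

Definition bstatement (Sg : nat -> Type) : Type := corner -> set (formula Sg).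

(** * B^PN-matrices *)

Record matrix (Sg : nat -> Type) (V : Type) : Type := Matrix {
  desA : set V;
  desR : set V;
  interp : forall k, Sg k -> ('I_k -> V) -> set V
}.

Definition dset (Sg : nat -> Type) (V : Type) (M : matrix Sg V) (a : corner)
    : set V :=
  match a with
  | Acc => desA M
  | NAcc => ~` desA M
  | Rej => desR M
  | NRej => ~` desR M
  end.

Definition valuation (Sg : nat -> Type) (V : Type) (M : matrix Sg V)
    (v : formula Sg -> V) : Prop :=
  forall k (c : Sg k) (args : 'I_k -> formula Sg),
    interp M c (fun i => v (args i)) (v (App c args)).

Definition holds (Sg : nat -> Type) (V : Type) (M : matrix Sg V)
    (Phi : bstatement Sg) : Prop :=
  ~ exists2 v, valuation M v & forall a, v @` Phi a `<=` dset M a.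

(** [psi^M(x)], for [psi] in the single variable [p]; it is empty when no
    valuation maps [p] to [x]. *)
Definition values_at (Sg : nat -> Type) (V : Type) (M : matrix Sg V) (p : nat)
    (psi : formula Sg) (x : V) : set V :=
  [set v psi | v in [set v | valuation M v /\ v (Var p) = x]].

Definition submatrix (Sg : nat -> Type) (V : Type) (M : matrix Sg V) (X : set V)
    : matrix Sg {x : V | X x} :=
  @Matrix Sg {x : V | X x}
    [set x | desA M (sval x)]
    [set x | desR M (sval x)]
    (fun k c args => [set y | interp M c (fun i => sval (args i)) (sval y)]).

Definition total (Sg : nat -> Type) (V : Type) (M : matrix Sg V) : Prop :=
  forall k (c : Sg k) (args : 'I_k -> V), interp M c args !=set0.

Definition total_sets (Sg : nat -> Type) (V : Type) (M : matrix Sg V)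
    : set (set V) :=
  [set Y | exists X : set V, [/\ X !=set0, total (submatrix M X) & Y `<=` X]].

(** * Discriminators *)

Definition separated (Sg : nat -> Type) (V : Type) (M : matrix Sg V) (a : corner)
    (X Y : set V) : Prop :=
  (X `<=` dset M a /\ Y `<=` ~` dset M a) \/
  (Y `<=` dset M a /\ X `<=` ~` dset M a).

Definition monadic_separator (Sg : nat -> Type) (V : Type) (M : matrix Sg V)
    (p : nat) (psi : formula Sg) (x y : V) : Prop :=
  single_var p psi /\
  exists2 a, a = Acc \/ a = Rej &
    separated M a (values_at M p psi x) (values_at M p psi y).

Definition isolates (Sg : nat -> Type) (V : Type) (M : matrix Sg V) (p : nat)
    (S : set (formula Sg)) (x : V) : Prop :=
  forall y, y <> x -> exists2 psi, S psi & monadic_separator M p psi x y.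

(** The last field says that the separators are filed under an index with
    respect to which they separate: [psi^M(x)] lies in [dset M a] (third field)
    and [psi^M(y)] in its complement.  The first three fields do not ensure it.
    Over the empty signature take two values [x], [y], both accepted, only [x]
    being rejected: then [p] separates them, by its rejection side, yet it may
    be filed under [Acc] for both, where it distinguishes nothing.  Likewise,
    when [psi^M(x)] is empty, [psi] may be filed for [x] under an index [a] with
    [psi^M(y)] inside [dset M a]. *)
Record discriminator (Sg : nat -> Type) (V : Type) (M : matrix Sg V) (p : nat)
    (Theta : V -> corner -> set (formula Sg)) : Prop := {
  discr_single_var : forall x a psi, Theta x a psi -> single_var p psi;
  discr_isolates : forall x, isolates M p (\bigcup_a Theta x a) x;
  discr_values : forall x a psi,
    Theta x a psi -> values_at M p psi x `<=` dset M a;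
  discr_filed : forall x y, y <> x ->
    exists a, exists2 psi, Theta x a psi &
      values_at M p psi y `<=` dset M (opp a)
}.

(** * Calculi and derivations *)

(** A rule schema, with antecedent [(anteA, anteR)] and succedent
    [(succA, succR)]. *)
Record rule (Sg : nat -> Type) : Type := Rule {
  anteA : set (formula Sg);
  anteR : set (formula Sg);
  succA : set (formula Sg);
  succR : set (formula Sg)
}.

Definition subst_rule (Sg : nat -> Type) (s : nat -> formula Sg) (r : rule Sg)
    : rule Sg :=
  Rule (subst s @` anteA r) (subst s @` anteR r)
       (subst s @` succA r) (subst s @` succR r).

Definition instance_of (Sg : nat -> Type) (C : set (rule Sg)) (r : rule Sg)
    : Prop :=
  exists2 r0, C r0 & exists s, r = subst_rule s r0.

Inductive label (Sg : nat -> Type) : Type :=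
| Star
| Seq of set (formula Sg) & set (formula Sg).
Arguments Star {Sg}.
Arguments Seq {Sg} _ _.

Definition applicable (Sg : nat -> Type) (r : rule Sg)
    (GA GR : set (formula Sg)) : Prop :=
  anteA r `<=` GA /\ anteR r `<=` GR.

(** [derivation C l] is the type of derivations with root labelled [l].
    Branching may be infinite; since the type is inductive, every branch
    ends in a leaf. *)
Inductive derivation (Sg : nat -> Type) (C : set (rule Sg))
    : label Sg -> Type :=
| Leaf : forall l, derivation C l
| Discontinue : forall GA GR (r : rule Sg),
    instance_of C r -> applicable r GA GR ->
    succA r `|` succR r = set0 ->
    derivation C Star ->
    derivation C (Seq GA GR)
| Expand : forall GA GR (r : rule Sg),
    instance_of C r -> applicable r GA GR ->
    succA r `|` succR r !=set0 ->
    (forall psi, succA r psi -> derivation C (Seq (GA `|` [set psi]) GR)) ->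
    (forall psi, succR r psi -> derivation C (Seq GA (GR `|` [set psi]))) ->
    derivation C (Seq GA GR).

Fixpoint all_leaves (Sg : nat -> Type) (C : set (rule Sg))
    (Q : label Sg -> Prop) (l : label Sg) (t : derivation C l) : Prop :=
  match t with
  | Leaf l => Q l
  | Discontinue _ _ _ _ _ _ t' => all_leaves Q t'
  | Expand _ _ _ _ _ _ tA tR =>
      (forall psi h, all_leaves Q (tA psi h)) /\
      (forall psi h, all_leaves Q (tR psi h))
  end.

Definition closed_label (Sg : nat -> Type) (Phi : bstatement Sg) (l : label Sg)
    : Prop :=
  match l with
  | Star => True
  | Seq GA GR => GA `&` Phi NAcc !=set0 \/ GR `&` Phi NRej !=set0
  end.

Definition provable (Sg : nat -> Type) (C : set (rule Sg)) (Phi : bstatement Sg)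
    : Prop :=
  exists GA GR (t : derivation C (Seq GA GR)),
    [/\ GA `<=` Phi Acc, GR `<=` Phi Rej & all_leaves (closed_label Phi) t].

(** * The calculus of a matrix with a discriminator *)

(** [(SA, SR)] is a choice for [X] with respect to [(a, b)].  The function [f]
    records both the chosen formula and the index it is chosen from, which
    matters when [Theta x a] and [Theta x b] overlap. *)
Definition is_choice (Sg : nat -> Type) (V : Type)
    (Theta : V -> corner -> set (formula Sg)) (X : set V) (a b : corner)
    (SA SR : set (formula Sg)) : Prop :=
  exists f : V -> corner * formula Sg,
    [/\ forall x, X x ->
          ((f x).1 = a \/ (f x).1 = b) /\ Theta x (f x).1 (f x).2,
        SA = [set psi | exists2 x, X x & f x = (a, psi)]
      & SR = [set psi | exists2 x, X x & f x = (b, psi)]].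

Definition P_set (Sg : nat -> Type) (V : Type) (M : matrix Sg V) (p : nat)
    (a : corner) (x : V) : set (formula Sg) :=
  [set phi | phi = Var p /\ dset M a x].

Definition rule_of (Sg : nat -> Type) (S : corner -> set (formula Sg)) : rule Sg :=
  Rule (S Acc) (S Rej) (S NAcc) (S NRej).

Inductive calculus (Sg : nat -> Type) (V : Type) (M : matrix Sg V) (p : nat)
    (Theta : V -> corner -> set (formula Sg)) : set (rule Sg) :=
| rule_exists (X : set V) (HA HR HNA HNR : set (formula Sg)) :
    is_choice Theta (~` X) Acc Rej HA HR ->
    is_choice Theta X NAcc NRej HNA HNR ->
    calculus M p Theta (Rule HNA HNR HA HR)
| rule_DA (x : V) :
    calculus M p Theta
      (Rule (Theta x Acc `|` P_set M p NAcc x) (Theta x Rej)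
            (Theta x NAcc `|` P_set M p Acc x) (Theta x NRej))
| rule_DR (x : V) :
    calculus M p Theta
      (Rule (Theta x Acc) (Theta x Rej `|` P_set M p NRej x)
            (Theta x NAcc) (Theta x NRej `|` P_set M p Rej x))
| rule_Sigma k (c : Sg k) (x : 'I_k -> V) (y : V) (q : 'I_k -> nat) :
    ~ interp M c x y -> injective q ->
    calculus M p Theta (rule_of (fun a =>
      \bigcup_i set_at p (Theta (x i) a) (Var (q i)) `|`
      set_at p (Theta y a) (App c (fun i => Var (q i)))))
| rule_T (X : set V) (q : V -> nat) :
    ~ total_sets M X -> {in X &, injective q} ->
    calculus M p Theta (rule_of (fun a =>
      \bigcup_(x in X) set_at p (Theta x a) (Var (q x)))).

(* Main.v *)
(** Under a valuation [w], the formulas of [Theta x] all take values in the sets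
    under which they are filed exactly when [w (Var p) = x].  So a valuation
    violating a rule would pin down the values of its parameters, which is
    impossible for each kind of rule; for (T), because the range of a valuation
    always induces a total sub-matrix.  Hence a valuation refuting [Phi] could be
    followed from the root of a proof of [Phi] up to a leaf that is not closed. *)
Require Import Defs.
From mathcomp Require Import all_boot.
From mathcomp Require Import boolp classical_sets.

Set Implicit Arguments.
Unset Strict Implicit.

Local Open Scope classical_set_scope.

Lemma dset_opp (Sg : nat -> Type) (V : Type) (M : matrix Sg V) (a : corner)
    (x : V) : dset M a x -> dset M (opp a) x -> False.
Proof. by case: a => /= h1 h2; exact: h2 || exact: h1. Qed.

Lemma valuation_subst (Sg : nat -> Type) (V : Type) (M : matrix Sg V)
    (w : formula Sg -> V) (s : nat -> formula Sg) :
  valuation M w -> valuation M (fun phi => w (subst s phi)).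
Proof. by move=> vw k c args; exact: vw. Qed.

(** Arguments in the range are values of formulas [g i], so the value of [App c g] is an admissible
    output that again lies in the range. *)
Lemma total_range (Sg : nat -> Type) (V : Type) (M : matrix Sg V)
    (w : formula Sg -> V) :
  valuation M w -> Defs.total (submatrix M (range w)).
Proof.
move=> vw k c args.
have /choice[g gE] i : exists phi, w phi = sval (args i).
  by case: (args i) => x /= [phi _ <-]; exists phi.
have rg : range w (w (App c g)) by exists (App c g).
exists (exist _ _ rg) => /=.
by have := vw _ c g; under eq_fun do rewrite gE.
Qed.

Lemma total_sets_range (Sg : nat -> Type) (V : Type) (M : matrix Sg V)
    (w : formula Sg -> V) (X : set V) :
  valuation M w -> X `<=` range w -> total_sets M X.
Proof.
move=> vw Xw; exists (range w); split=> //; last exact: total_range.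
by exists (w (Var 0)), (Var 0).
Qed.

Lemma discr_value (Sg : nat -> Type) (V : Type) (M : matrix Sg V) (p : nat)
    (Theta : V -> corner -> set (formula Sg))
    (w : formula Sg -> V) (a : corner) (psi : formula Sg) :
  discriminator M p Theta ->
  valuation M w -> Theta (w (Var p)) a psi -> dset M a (w psi).
Proof. by move=> dT vw /(discr_values dT); apply; exists w. Qed.

(** If [Var p] had another value [y], then [discr_filed] would give a formula filed for [x] under
    some [a] whose values at [y] all lie in [opp a]; its value under [w] would be in both. *)
Lemma discr_unique (Sg : nat -> Type) (V : Type) (M : matrix Sg V) (p : nat)
    (Theta : V -> corner -> set (formula Sg))
    (w : formula Sg -> V) (x : V) :
  discriminator M p Theta ->
  valuation M w ->
  (forall a psi, Theta x a psi -> dset M a (w psi)) -> w (Var p) = x.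
Proof.
move=> dT vw hx; apply: contrapT => /(discr_filed dT)[a [psi /hx wa]].
by move=> /(_ (w psi)) wo; apply: (dset_opp wa); apply: wo; exists w.
Qed.

Lemma discr_unique_at (Sg : nat -> Type) (V : Type) (M : matrix Sg V) (p : nat)
    (Theta : V -> corner -> set (formula Sg))
    (w : formula Sg -> V) (x : V) (phi : formula Sg) :
  discriminator M p Theta ->
  valuation M w ->
  (forall a psi, set_at p (Theta x a) phi psi -> dset M a (w psi)) ->
  w phi = x.
Proof.
move=> dT vw hx.
(* Precomposing [w] with the substitution of [phi] for [p] yields a valuation sending [Var p] to
   [w phi]. *)
have := discr_unique dT
  (valuation_subst (fun n => if n == p then phi else Var n) vw).
rewrite /= eqxx; apply=> a psi Tpsi.
by apply: hx; exists psi.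
Qed.

(** A valuation violates a rule by satisfying its antecedent and no formula of its succedent; the
    succedent therefore sits at the negative corners. *)
Definition rule_statement (Sg : nat -> Type) (r : rule Sg) : bstatement Sg :=
  fun a => match a with
  | Acc => anteA r | NAcc => succA r | Rej => anteR r | NRej => succR r
  end.

Lemma holds_subst_rule (Sg : nat -> Type) (V : Type) (M : matrix Sg V)
    (s : nat -> formula Sg) (r : rule Sg) :
  holds M (rule_statement r) -> holds M (rule_statement (subst_rule s r)).
Proof.
move=> hr [w vw hw]; apply: hr.
exists (fun phi => w (subst s phi)); first exact: valuation_subst.
by move=> a _ [psi rpsi <-]; apply: (hw a); exists (subst s psi) => //;
  case: a rpsi => rpsi; exists psi.
Qed.

Lemma calculus_holds (Sg : nat -> Type) (V : Type) (M : matrix Sg V) (p : nat)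
    (Theta : V -> corner -> set (formula Sg)) (r : rule Sg) :
  discriminator M p Theta -> calculus M p Theta r ->
  holds M (rule_statement r).
Proof.
move=> dT Cr [w vw hw].
have {}hw a psi : rule_statement r a psi -> dset M a (w psi).
  by move=> rpsi; apply: (hw a); exists psi.
case: Cr hw => {r}.
- move=> X HA HR HNA HNR [f [fX -> ->]] [g [gX -> ->]] hw.
  (* The formula chosen for the value of [Var p] occurs in the antecedent if this value is in [X],
     in the succedent otherwise. Either way the violation places it in the corner opposite to the
     one given by [discr_value]. *)
  have [wX|wX] := pselect (X (w (Var p))).
    have [] := gX _ wX; case E: (g _) => [a psi] /= aE /(discr_value dT vw) wa.
    apply: (dset_opp wa); apply: hw.
    by case: aE E {wa} => -> E; exists (w (Var p)).
  have [] := fX _ wX; case E: (f _) => [a psi] /= aE /(discr_value dT vw) wa.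
  apply: (dset_opp wa); apply: hw.
  by case: aE E {wa} => -> E; exists (w (Var p)).
- move=> x hw.
  have wx : w (Var p) = x.
    by apply: (discr_unique dT vw) => -[] psi h; apply: hw => //=; left.
  (* Now [Var p] has value [x], but [P_set] puts it on the side where a violation contradicts the
     acceptance status of [x]. *)
  have [Dx|Dx] := pselect (dset M Acc x).
    by apply: (hw NAcc (Var p)); [right | rewrite wx].
  by apply: (Dx); rewrite -wx; apply: (hw Acc); right.
- move=> x hw.
  have wx : w (Var p) = x.
    by apply: (discr_unique dT vw) => -[] psi h; apply: hw => //=; left.
  have [Dx|Dx] := pselect (dset M Rej x).
    by apply: (hw NRej (Var p)); [right | rewrite wx].
  by apply: (Dx); rewrite -wx; apply: (hw Rej); right.
- move=> k c x y q nxy _ hw; apply: nxy.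
  have wq i : w (Var (q i)) = x i.
    by apply: (discr_unique_at dT vw) => -[] psi h; apply: hw; left; exists i.
  have <- : w (App c (fun i => Var (q i))) = y.
    by apply: (discr_unique_at dT vw) => -[] psi h; apply: hw; right.
  by have := vw _ c (fun i => Var (q i)); under eq_fun do rewrite wq.
(* Each [x] in [X] is attained by [w] at the variable [q x]. *)
- move=> X q nX _ hw; apply: nX; apply: (total_sets_range vw) => x Xx.
  exists (Var (q x)) => //.
  by apply: (discr_unique_at dT vw) => -[] psi h; apply: hw; exists x.
Qed.

(** Induction on the tree: if [w] satisfied a node, then by soundness of the applied instance it
    would satisfy a child. Nothing is claimed of [Star], as an instance with empty succedent is
    contradicted by [w] directly. *)
Lemma derivation_sound (Sg : nat -> Type) (V : Type) (M : matrix Sg V)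
    (C : set (rule Sg)) (Phi : bstatement Sg) (w : formula Sg -> V) :
  (forall r, C r -> holds M (rule_statement r)) ->
  valuation M w -> (forall a, w @` Phi a `<=` dset M a) ->
  forall l (t : derivation C l), all_leaves (closed_label Phi) t ->
  if l is Seq GA GR then
    ~ (w @` GA `<=` dset M Acc /\ w @` GR `<=` dset M Rej)
  else True.
Proof.
move=> hC vw hPhi l t.
have inst_holds r : instance_of C r -> holds M (rule_statement r).
  by move=> [r0 /hC hr0 [s ->]]; exact: holds_subst_rule.
elim: t => {l}.
- case=> [//|GA GR] /= [] [psi [Gpsi Ppsi]] [hA hR].
    by apply: (hPhi NAcc (w psi)); [exists psi | apply: hA; exists psi].
  by apply: (hPhi NRej (w psi)); [exists psi | apply: hR; exists psi].
- move=> GA GR r /inst_holds hr [rA rR] r0 _ _ _ [hA hR]; apply: hr.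
  exists w => // -[] _ [psi /= rpsi <-].
  + by apply: hA; exists psi => //; exact: rA.
  + suff: (set0 : set (formula Sg)) psi by [].
    by rewrite -r0; left.
  + by apply: hR; exists psi => //; exact: rR.
  + suff: (set0 : set (formula Sg)) psi by [].
    by rewrite -r0; right.
- move=> GA GR r /inst_holds hr [rA rR] _ tA IHA tR IHR /= [lA lR] [hA hR].
  apply: hr; exists w => // -[] _ [psi /= rpsi <-].
  + by apply: hA; exists psi => //; exact: rA.
  (* Were [psi] accepted, [w] would satisfy the child that adds [psi], against the induction
     hypothesis. *)
  + move=> wpsi; apply: (IHA psi rpsi (lA _ _)); split=> // _ [chi [Gchi|->] <-//].
    by apply: hA; exists chi.
  + by apply: hR; exists psi => //; exact: rR.
  + move=> wpsi; apply: (IHR psi rpsi (lR _ _)); split=> // _ [chi [Gchi|->] <-//].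
    by apply: hR; exists chi.
Qed.

Theorem theorem1 (Sg : nat -> Type) (V : Type) (M : matrix Sg V) (p : nat)
    (Theta : V -> corner -> set (formula Sg)) :
  discriminator M p Theta ->
  forall Phi : bstatement Sg, provable (calculus M p Theta) Phi -> holds M Phi.
Proof.
move=> dT Phi [GA [GR [t [sA sR ht]]]] [w vw hw].
have := @derivation_sound _ _ _ _ _ _ (fun r => @calculus_holds _ _ _ _ _ r dT)
  vw hw _ t ht.
by apply; split=> _ [psi Gpsi <-];
  [apply: (hw Acc); exists psi => //; exact: sA
  |apply: (hw Rej); exists psi => //; exact: sR].
Qed.
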